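(* Let an algebra $A$ over a field $K$ of characteristic zero satisfy the commutative centralizer condition. (1) Let $a,b\in A\setminus Z(A)$. Then $ab=ba$ if and only if $C(a)=C(b)$; and $ab\ne ba$ if and only if $C(a)\cap C(b)=Z(A)$. (2) Let $C$ be a maximal commutative subalgebra of $A$, let $a\in A\setminus Z(A)$, and let $p(t)\in Z(A)[t]$ be a polynomial of positive degree with coefficients from $Z(A)$. If $p(a)\in C\setminus Z(A)$ then $a\in C$.
   Context: $Z(A)$ is the centre of $A$ and $C(a)=\{b\in A: ab=ba\}$ is the centralizer of $a\in A$. A noncommutative algebra $A$ satisfies the commutative centralizer condition if the centralizer of each element of $A\setminus Z(A)$ is a commutative algebra. *)

(* Defs.v *)
From mathcomp Require Import all_boot all_algebra.
From mathcomp Require Import boolp classical_sets.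

Set Implicit Arguments.
Unset Strict Implicit.
Unset Printing Implicit Defensive.

Import GRing.Theory.
Local Open Scope ring_scope.
Local Open Scope classical_set_scope.

Definition center (R : pzRingType) : set R := [set a | forall b, GRing.comm a b].
Arguments center R : clear implicits.

Definition centralizer (R : pzRingType) (a : R) : set R :=
  [set b | GRing.comm a b].

Definition commuting_set (R : pzRingType) (S : set R) : Prop :=
  forall x y, S x -> S y -> GRing.comm x y.

(* Only commutativity is required of [centralizer a]: centralizers are always
   subalgebras. *)
Definition commutative_centralizer_condition (R : pzRingType) : Prop :=
  ~ commuting_set [set: R] /\
  (forall a : R, ~ center R a -> commuting_set (centralizer a)).

(* Subalgebras contain 1. *)
Definition commutative_subalgebra (K : pzRingType) (A : lalgType K)
    (C : set A) : Prop :=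
  GRing.subalg_closed [in C] /\ commuting_set C.

Definition maximal_commutative_subalgebra (K : pzRingType) (A : lalgType K)
    (C : set A) : Prop :=
  commutative_subalgebra C /\
  (forall D : set A, commutative_subalgebra D -> C `<=` D -> D = C).

(* Main.v *)
Require Import Defs.
From mathcomp Require Import all_boot all_algebra.
From mathcomp Require Import boolp classical_sets.

Set Implicit Arguments.
Unset Strict Implicit.
Unset Printing Implicit Defensive.

Import GRing.Theory.
Local Open Scope ring_scope.
Local Open Scope classical_set_scope.

(** Under the commutative centralizer condition, two elements that commute with
    a common noncentral element commute with each other.  Hence commutation is
    transitive on noncentral elements, so it is an equivalence relation there,
    with the sets C(a) \ Z(A) as classes: this is part (1)
    ([centralizer_eqP], [centralizer_capP]).

    It also follows that the maximal commutative subalgebra through a noncentral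
    element c is unique, namely C(c): every commutative subalgebra containing c
    lies in C(c), and C(c) is itself a commutative subalgebra
    ([maximal_commutative_eq_centralizer]).  In part (2) the noncentral element
    is c = p(a).  A polynomial in a with central coefficients commutes with a, so
    a lies in C(p(a)), which is C. *)

Section CommutativeCentralizers.

Variable R : pzRingType.
Hypothesis ccR : commutative_centralizer_condition R.
Implicit Types a b c x : R.

Lemma comm_trans_noncentral c a b :
  ~ center R c -> GRing.comm c a -> GRing.comm c b -> GRing.comm a b.
Proof. by move=> cNZ ca cb; exact: (ccR.2 c cNZ). Qed.

Lemma sub_centralizer_comm a b :
  ~ center R a -> GRing.comm a b -> centralizer a `<=` centralizer b.
Proof. by move=> aNZ ab x ax; exact: comm_trans_noncentral aNZ ab ax. Qed.

Lemma centralizer_eqP a b : ~ center R a -> ~ center R b ->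
  GRing.comm a b <-> centralizer a = centralizer b.
Proof.
move=> aNZ bNZ; split=> [ab|Cab].
  by apply/seteqP; split; apply: sub_centralizer_comm.
have : centralizer b b by [].
by rewrite -Cab.
Qed.

(** A noncentral x commuting with both a and b would make them commute;
    conversely, if a and b commute then a itself is in the intersection. *)
Lemma centralizer_capP a b : ~ center R a ->
  ~ GRing.comm a b <-> centralizer a `&` centralizer b = center R.
Proof.
move=> aNZ; split=> [abN|capZ ab].
  apply/seteqP; split=> [x [ax bx]|x xZ]; last first.
    by split; apply: commr_sym; apply: xZ.
  apply: contrapT => xNZ; apply: abN.
  exact: comm_trans_noncentral xNZ (commr_sym ax) (commr_sym bx).
by apply: aNZ; rewrite -capZ; split=> //; exact: commr_sym.
Qed.

End CommutativeCentralizers.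

Lemma comm_horner_center (R : nzRingType) (p : {poly R}) (a : R) :
  p \is a polyOver [in center R] -> GRing.comm a p.[a].
Proof.
rewrite qualifE => /allP pZ; apply: commr_horner => // i.
have [i_lt|i_ge] := ltnP i (size p); last first.
  by rewrite nth_default // mul0r mulr0.
by have /set_mem := pZ _ (mem_nth 0 i_lt); apply.
Qed.

Lemma centralizer_subalg_closed (K : pzRingType) (A : algType K) (a : A) :
  GRing.subalg_closed [in centralizer a].
Proof.
split=> [|k x y|x y]; rewrite ?inE.
- exact: commr1.
- rewrite /centralizer /= => ax ay; apply: commrD => //.
  by rewrite /GRing.comm -scalerAr -scalerAl ax.
- exact: commrM.
Qed.

Lemma maximal_commutative_eq_centralizer (K : pzRingType) (A : algType K)
    (C : set A) (c : A) :
  commutative_centralizer_condition A -> maximal_commutative_subalgebra C ->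
  C c -> ~ center A c -> centralizer c = C.
Proof.
move=> ccA [[_ Ccomm] Cmax] Cc cNZ; apply: Cmax => [|x Cx].
  by split; [exact: centralizer_subalg_closed | exact: ccA.2].
exact: Ccomm.
Qed.

(* [p.[a]] is Horner evaluation; coefficients are central, so it is the usual
   value of p at a. *)
Theorem corollary4p2 (K : fieldType) (charK0 : [pchar K] =i pred0)
    (A : algType K) (ccA : commutative_centralizer_condition A) :
  (forall a b : A, ~ center A a -> ~ center A b ->
     (a * b = b * a <-> centralizer a = centralizer b) /\
     (a * b <> b * a <-> centralizer a `&` centralizer b = center A)) /\
  (forall (C : set A) (a : A) (p : {poly A}),
     maximal_commutative_subalgebra C ->
     ~ center A a ->
     p \is a polyOver [in center A] ->
     (1 < size p)%N ->
     (C `\` center A) p.[a] ->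
     C a).
Proof.
split=> [a b aNZ bNZ|C a p Cmax _ pZ _ [Cpa paNZ]].
  by split; [exact: centralizer_eqP | exact: centralizer_capP].
rewrite -(maximal_commutative_eq_centralizer ccA Cmax Cpa paNZ).
exact: commr_sym (comm_horner_center a pZ).
Qed.
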